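(* Let $0<k<n$ be integers, let $(Q,W)$ be the rectangular quiver with potential of the Grassmannian $Gr(k,n)$, and let $J=J(Q,W)$ be its Jacobian algebra. For every vertex $i$ of $Q$, the non-zero coefficients of the polynomial $F_{I_i}$ are equal to $1$, where $I_i$ is the injective hull of the simple right $J$-module concentrated at $i$.
   Context: The quiver $Q$ has vertices $(p,q)$ with $1\le p\le n-k-1$, $1\le q\le k-1$, and arrows $a:(p,q)\to(p+1,q)$, $b:(p,q)\to(p,q+1)$, $c:(p,q)\to(p-1,q-1)$ whenever both ends are vertices. The potential $W$ is the sum of all 3-cycles $(p,q)\xrightarrow{a}(p+1,q)\xrightarrow{b}(p+1,q+1)\xrightarrow{c}(p,q)$ minus the sum of all 3-cycles $(p,q)\xrightarrow{b}(p,q+1)\xrightarrow{a}(p+1,q+1)\xrightarrow{c}(p,q)$. The Jacobian algebra $J(Q,W)$ is the quotient of the completed path algebra $\widehat{\mathbb{C}Q}$ by the closure of the ideal generated by the cyclic derivatives $\partial_\alpha W$, $\alpha\in Q_1$, where $\partial_\alpha$ sends the class of a path $w$ to $\sum_{w=u\alpha v}vu$. Paths are composed from right to left, so $e_jJe_i$ is spanned by (classes of) paths from $i$ to $j$, and $I_ie_j=\mathrm{Hom}_{\mathbb{C}}(e_jJe_i,\mathbb{C})$. For a finite-dimensional right $J$-module $M$, its $F$-polynomial is $F_M(y)=\sum_{\mathbf{e}}\chi(Gr_{\mathbf{e}}(M))\prod_{j\in Q_0} y_j^{e_j}$, where $Gr_{\mathbf{e}}(M)$ is the complex projective variety of submodules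 of $M$ of dimension vector $\mathbf{e}=(e_j)_{j\in Q_0}$ and $\chi$ denotes the Euler characteristic. *)

(* Defs.v *)
From HB Require Import structures.
From mathcomp Require Import all_boot all_order all_algebra.
From mathcomp Require Import finmap complex.
From mathcomp Require Import all_classical all_reals topology.
(* The notations of monalg clash with those of topology. *)
From mathcomp Require Import -(notations) monalg.

Set Implicit Arguments.
Unset Strict Implicit.
Unset Printing Implicit Defensive.

Import Order.TTheory GRing.Theory Num.Theory.
Import numFieldTopology.Exports.

Local Open Scope ring_scope.

Record quiver := Quiver {
  vertex : finType;
  arrow : finType;
  src : arrow -> vertex;
  tgt : arrow -> vertex }.

Section Paths.
Variable Q : quiver.
Implicit Types (i : vertex Q) (s : seq (arrow Q)).

(* Paths are composed from right to left: the path a_m ... a_1 starting at i,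
   which follows a_1 first, is stored as (i, [:: a_m; ...; a_1]). *)
Definition endpoint i s := if s is a :: _ then tgt a else i.

Fixpoint is_path i s :=
  if s is a :: s' then (src a == endpoint i s') && is_path i s' else true.

Definition qpath := {p : vertex Q * seq (arrow Q) | is_path p.1 p.2}.

Definition psrc (p : qpath) := (val p).1.
Definition parr (p : qpath) := (val p).2.
Definition ptgt (p : qpath) := endpoint (psrc p) (parr p).
Definition plen (p : qpath) := size (parr p).

Lemma is_path_cat i s t :
  is_path i (s ++ t) = is_path (endpoint i t) s && is_path i t.
Proof.
elim: s => //= a s ->; rewrite andbA; congr (_ && _ && _).
by case: s.
Qed.

Lemma ptake_subproof (l : nat) (p : qpath) :
  is_path (endpoint (psrc p) (drop l (parr p))) (take l (parr p)).
Proof.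
by have := valP p; rewrite -{1}(cat_take_drop l (val p).2) is_path_cat => /andP[].
Qed.

Lemma pdrop_subproof (l : nat) (p : qpath) :
  is_path (psrc p) (drop l (parr p)).
Proof.
by have := valP p; rewrite -{1}(cat_take_drop l (val p).2) is_path_cat => /andP[].
Qed.

(* The factorisations p = u v of a path are the pairs
   (u, v) = (ptake l p, pdrop l p) for 0 <= l <= plen p. *)
Definition ptake l p : qpath :=
  exist _ (endpoint (psrc p) (drop l (parr p)), take l (parr p))
        (ptake_subproof l p).
Definition pdrop l p : qpath :=
  exist _ (psrc p, drop l (parr p)) (pdrop_subproof l p).

Lemma psrc_take l p : psrc (ptake l p) = endpoint (psrc p) (drop l (parr p)).
Proof. by []. Qed.
Lemma parr_take l p : parr (ptake l p) = take l (parr p). Proof. by []. Qed.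
Lemma psrc_drop l p : psrc (pdrop l p) = psrc p. Proof. by []. Qed.
Lemma parr_drop l p : parr (pdrop l p) = drop l (parr p). Proof. by []. Qed.
Definition pathE := (psrc_take, parr_take, psrc_drop, parr_drop).

Lemma plen_take l p : (l <= plen p)%N -> plen (ptake l p) = l.
Proof. exact: size_takel. Qed.

Lemma plen_drop l p : plen (pdrop l p) = (plen p - l)%N.
Proof. exact: size_drop. Qed.

Lemma qpath_eq (p q : qpath) : psrc p = psrc q -> parr p = parr q -> p = q.
Proof. by case: p q => [[i s] ps] [[j t] pt] /= ? ?; apply/val_inj; congr pair. Qed.

End Paths.

(* An element of the completed path algebra is an arbitrary (possibly
   infinite) formal linear combination of paths, i.e. the function of its
   coefficients. *)
Definition cpalg (F : fieldType) (Q : quiver) := qpath Q -> F^o.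

HB.instance Definition _ F Q := GRing.Lmodule.on (cpalg F Q).

Section CompletedPathAlgebra.
Variables (F : fieldType) (Q : quiver).
Implicit Types (x y z : cpalg F Q) (p : qpath Q).

Definition cpa_one : cpalg F Q := fun p => (plen p == 0)%:R.

Definition cpa_mul x y : cpalg F Q :=
  fun p => \sum_(l < (plen p).+1) (x (ptake l p) : F) * y (pdrop l p).

Lemma cpa_mulA : associative cpa_mul.
Proof.
move=> x y z; apply/funext => p; rewrite /cpa_mul.
set n := plen p.
pose G (a b : nat) : F :=
  x (ptake a p) * y (pdrop a (ptake b p)) * z (pdrop b p).
transitivity (\sum_(a < n.+1) \sum_(b < n.+1 | (a <= b)%N) G a b).
  apply: eq_bigr => a _; rewrite big_distrr /=.
  have an : (a <= n)%N by rewrite -ltnS.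
  rewrite plen_drop -/n.
  transitivity (\sum_(0 <= m < (n - a).+1) G a (m + a)%N).
    rewrite big_mkord; apply: eq_bigr => m _; rewrite mulrA /G.
    have -> : ptake m (pdrop a p) = pdrop a (ptake (m + a) p).
      by apply: qpath_eq; rewrite !pathE ?drop_drop ?take_drop.
    suff -> : pdrop m (pdrop a p) = pdrop (m + a) p by [].
    by apply: qpath_eq; rewrite !pathE // drop_drop.
  rewrite -(big_mkord (fun b => a <= b)%N (G a)).
  rewrite [RHS](@big_cat_nat _ _ _ a) ?leqW //=.
  rewrite [X in _ = X + _]big_nat_cond [X in _ = X + _]big1 ?add0r; last first.
    by move=> b /andP[/andP[_ ba]]; rewrite leqNgt ba.
  have := big_addn 0 n.+1 a (fun b => a <= b)%N (G a).
  rewrite add0n subSn // => ->.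
  by apply: eq_bigl => b; rewrite leq_addl.
rewrite (exchange_big_dep xpredT) //=.
apply: eq_bigr => b _; rewrite big_distrl /=.
have bn : (b <= n)%N by rewrite -ltnS.
rewrite plen_take //.
rewrite -(big_mkord (fun a => a <= b)%N (fun a => G a b)).
rewrite (@big_cat_nat _ _ _ b.+1) //= [X in _ + X]big_nat_cond.
rewrite [X in _ + X]big1 ?addr0 => [|a]; last first.
  by case/andP=> /andP[ba _]; rewrite leqNgt ba.
rewrite big_mkord; apply: eq_big => [a|a _]; first by rewrite -ltnS ltn_ord.
have ab : (a <= b)%N by rewrite -ltnS.
rewrite /G; congr (_ * _ * _); congr x; apply: qpath_eq; rewrite !pathE.
  rewrite -{1}[parr p](cat_take_drop b) drop_cat size_takel //.
  move: ab; rewrite leq_eqVlt => /orP[/eqP->|ab].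
    by rewrite ltnn subnn drop0 [drop b (take b _)]drop_oversize // size_takel.
  by rewrite ab; case: (drop a _).
by rewrite take_takel.
Qed.

Lemma cpa_mul1l : left_id cpa_one cpa_mul.
Proof.
move=> x; apply/funext => p; rewrite /cpa_mul big_ord_recl big1 => [|l _].
  rewrite /cpa_one plen_take // eqxx mul1r addr0; congr x.
  by apply: qpath_eq; rewrite !pathE ?drop0.
by rewrite /cpa_one plen_take ?mul0r // -ltnS ltn_ord.
Qed.

Lemma cpa_mul1r : right_id cpa_one cpa_mul.
Proof.
move=> x; apply/funext => p; rewrite /cpa_mul big_ord_recr big1 /= => [|l _].
  rewrite /cpa_one plen_drop subnn eqxx mulr1 add0r; congr x.
  by apply: qpath_eq; rewrite !pathE ?drop_size // take_size.
by rewrite /cpa_one plen_drop subn_eq0 leqNgt ltn_ord mulr0.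
Qed.

Lemma cpa_mulDl : left_distributive cpa_mul +%R.
Proof.
move=> x y z; apply/funext => p; rewrite /cpa_mul.
rewrite -[RHS]big_split; apply: eq_bigr => l _; exact: mulrDl.
Qed.

Lemma cpa_mulDr : right_distributive cpa_mul +%R.
Proof.
move=> x y z; apply/funext => p; rewrite /cpa_mul.
rewrite -[RHS]big_split; apply: eq_bigr => l _; exact: mulrDr.
Qed.

HB.instance Definition _ := GRing.Zmodule_isPzRing.Build (cpalg F Q)
  cpa_mulA cpa_mul1l cpa_mul1r cpa_mulDl cpa_mulDr.

Lemma cpa_scaleAl (a : F) x y : a *: (x * y) = (a *: x) * y.
Proof.
apply/funext => p; rewrite [LHS]big_distrr.
by apply: eq_bigr => l _; exact: mulrA.
Qed.

Lemma cpa_scaleAr (a : F) x y : a *: (x * y) = x * (a *: y).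
Proof.
apply/funext => p; rewrite [LHS]big_distrr.
by apply: eq_bigr => l _; exact: mulrCA.
Qed.

(* The path (i, s), or 0 if (i, s) is not a path. *)
Definition cpa_path (i : vertex Q) (s : seq (arrow Q)) : cpalg F Q :=
  fun p => (val p == (i, s))%:R.

Definition cpa_idem i := cpa_path i [::].

(* The coefficient of x at (i, s), or 0 if (i, s) is not a path. *)
Definition cpa_coef x (i : vertex Q) (s : seq (arrow Q)) : F :=
  if insub (i, s) is Some p then x p else 0.

End CompletedPathAlgebra.

Section Jacobian.
Variables (F : fieldType) (Q : quiver).
Implicit Types (W x y z : cpalg F Q).

(* The cyclic derivative sends a cycle w to the sum of v u over all
   factorisations w = u a v; so the coefficient at p of the derivative of W is
   the sum, over all p = v u, of the coefficient of W at u a v, provided that p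
   goes from the target of a to its source (so that u a v is a cycle). *)
Definition cyclic_derivative (a : arrow Q) W : cpalg F Q := fun p =>
  if (psrc p == tgt a) && (ptgt p == src a) then
    \sum_(l < (plen p).+1)
      cpa_coef W (psrc (ptake l p)) (parr (pdrop l p) ++ a :: parr (ptake l p))
  else 0.

Definition jacobian_ideal W x : Prop :=
  exists s : seq (cpalg F Q * arrow Q * cpalg F Q),
    x = \sum_(t <- s) t.1.1 * cyclic_derivative t.1.2 W * t.2.

(* The closure for the topology whose neighbourhoods of 0 are the powers of the
   arrow ideal, i.e. the sets of x vanishing on all paths of length < N. *)
Definition jacobian_closure W x : Prop :=
  forall N : nat, exists2 y, jacobian_ideal W y &
    forall p : qpath Q, (plen p < N)%N -> x p = y p.

Variable W : cpalg F Q.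

Definition jclosure : {pred cpalg F Q} := fun x => `[< jacobian_closure W x >].

Lemma jideal0 : jacobian_ideal W 0.
Proof. by exists [::]; rewrite big_nil. Qed.

Lemma jidealD x y :
  jacobian_ideal W x -> jacobian_ideal W y -> jacobian_ideal W (x + y).
Proof. by move=> [s ->] [t ->]; exists (s ++ t); rewrite big_cat. Qed.

Lemma jidealMl x y : jacobian_ideal W y -> jacobian_ideal W (x * y).
Proof.
move=> [s ->]; exists [seq (x * t.1.1, t.1.2, t.2) | t <- s].
by rewrite big_map mulr_sumr; apply: eq_bigr => t _; rewrite !mulrA.
Qed.

Lemma jidealMr x y : jacobian_ideal W y -> jacobian_ideal W (y * x).
Proof.
move=> [s ->]; exists [seq (t.1.1, t.1.2, t.2 * x) | t <- s].
by rewrite big_map mulr_suml; apply: eq_bigr => t _; rewrite !mulrA.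
Qed.

Lemma jclosure_zmod_closed : zmod_closed jclosure.
Proof.
split; first by apply/asboolP => N; exists 0 => //; exact: jideal0.
move=> x y /asboolP Ix /asboolP Iy; apply/asboolP => N.
have [x' Ix' xx'] := Ix N; have [y' Iy' yy'] := Iy N.
exists (x' - y') => [|p pN]; last by rewrite !fctE xx' ?yy'.
by rewrite -mulN1r; apply: jidealD => //; exact: jidealMl.
Qed.

HB.instance Definition _ := GRing.isZmodClosed.Build _ jclosure
  jclosure_zmod_closed.

Lemma jclosureMl x y : y \in jclosure -> x * y \in jclosure.
Proof.
move=> /asboolP Iy; apply/asboolP => N; have [y' Iy' yy'] := Iy N.
exists (x * y') => [|p pN]; first exact: jidealMl.
apply: eq_bigr => l _; rewrite yy' //; apply: leq_ltn_trans pN.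
by rewrite /plen /= size_drop leq_subr.
Qed.

Lemma jclosureMr x y : y \in jclosure -> y * x \in jclosure.
Proof.
move=> /asboolP Iy; apply/asboolP => N; have [y' Iy' yy'] := Iy N.
exists (y' * x) => [|p pN]; first exact: jidealMr.
apply: eq_bigr => l _; rewrite yy' //; apply: leq_ltn_trans pN.
by rewrite /plen /= size_take_min geq_minr.
Qed.

Lemma jclosureZ (a : F) x : x \in jclosure -> a *: x \in jclosure.
Proof. by move=> Ix; rewrite -[x]mul1r cpa_scaleAl; exact: jclosureMl. Qed.

Definition jacobian_algebra := Quotient.quot jclosure.

HB.instance Definition _ := GRing.Zmodule.on jacobian_algebra.
HB.instance Definition _ :=
  EqQuotient.on jacobian_algebra.

Definition jpi : cpalg F Q -> jacobian_algebra := (\pi_jacobian_algebra)%qT.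

Lemma jpiP x y : jpi x = jpi y <-> x - y \in jclosure.
Proof. by rewrite Quotient.idealrBE; split => [/eqP|/eqP]. Qed.

Lemma jpiK (u : jacobian_algebra) : jpi (repr u) = u.
Proof. exact: reprK. Qed.

Lemma jpiD x y : jpi (x + y) = jpi x + jpi y.
Proof. exact: Quotient.pi_add. Qed.

Definition jone := jpi 1.
Definition jmul (u v : jacobian_algebra) := jpi (repr u * repr v).
Definition jscale (a : F) (u : jacobian_algebra) := jpi (a *: repr u).

Lemma repr_jpi x : repr (jpi x) - x \in jclosure.
Proof. by apply/jpiP; rewrite jpiK. Qed.

Lemma jpiM x y : jpi (x * y) = jmul (jpi x) (jpi y).
Proof.
apply/esym/jpiP; set x' := repr _; set y' := repr _.
have -> : x' * y' - x * y = x' * (y' - y) + (x' - x) * y.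
  by rewrite mulrBr mulrBl addrA subrK.
by apply: rpredD; [apply: jclosureMl|apply: jclosureMr]; exact: repr_jpi.
Qed.

Lemma jpiZ a x : jpi (a *: x) = jscale a (jpi x).
Proof. by apply/esym/jpiP; rewrite -scalerBr jclosureZ ?repr_jpi. Qed.

Lemma jmulA : associative jmul.
Proof.
move=> u v w; rewrite -[u]jpiK -[v]jpiK -[w]jpiK.
by rewrite -!jpiM mulrA.
Qed.

Lemma jmul1l : left_id jone jmul.
Proof. by move=> u; rewrite -[u]jpiK -jpiM mul1r. Qed.

Lemma jmul1r : right_id jone jmul.
Proof. by move=> u; rewrite -[u]jpiK -jpiM mulr1. Qed.

Lemma jmulDl : left_distributive jmul +%R.
Proof.
move=> u v w; rewrite -[u]jpiK -[v]jpiK -[w]jpiK.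
by rewrite -jpiD -!jpiM -jpiD mulrDl.
Qed.

Lemma jmulDr : right_distributive jmul +%R.
Proof.
move=> u v w; rewrite -[u]jpiK -[v]jpiK -[w]jpiK.
by rewrite -jpiD -!jpiM -jpiD mulrDr.
Qed.

HB.instance Definition _ := GRing.Zmodule_isPzRing.Build jacobian_algebra
  jmulA jmul1l jmul1r jmulDl jmulDr.

Lemma jscaleA a b u : jscale a (jscale b u) = jscale (a * b) u.
Proof. by rewrite -[u]jpiK -!jpiZ scalerA. Qed.

Lemma jscale1 : left_id 1 jscale.
Proof. by move=> u; rewrite -[u]jpiK -!jpiZ scale1r. Qed.

Lemma jscaleDr : right_distributive jscale +%R.
Proof.
move=> a u v; rewrite -[u]jpiK -[v]jpiK.
by rewrite -jpiD -!jpiZ -jpiD scalerDr.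
Qed.

Lemma jscaleDl u : {morph jscale^~ u : a b / a + b}.
Proof. by move=> a b; rewrite -[u]jpiK -!jpiZ -jpiD scalerDl. Qed.

HB.instance Definition _ := GRing.Zmodule_isLmodule.Build F jacobian_algebra
  jscaleA jscale1 jscaleDr jscaleDl.

Definition jidem (i : vertex Q) : jacobian_algebra := jpi (cpa_idem F i).

End Jacobian.

(* A right module structure on F^d, d = rdim, in a basis: x in the algebra
   sends a row vector v to v *m ract x.  Since row vectors are acted upon from
   the right, v (x y) = (v x) y says that ract is a ring morphism. *)
Record rmodule (F : fieldType) (Q : quiver) (W : cpalg F Q) := RModule {
  rdim : nat;
  ract : {rmorphism jacobian_algebra W -> 'M[F]_rdim};
  ract_scalable : scalable ract }.

Section Modules.
Variables (F : fieldType) (Q : quiver) (W : cpalg F Q).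
Local Notation J := (jacobian_algebra W).
Implicit Types M N S I : rmodule W.

(* Subspaces are given by the row space of a matrix, as in mxalgebra. *)
Definition submodule M m (V : 'M[F]_(m, rdim M)) : Prop :=
  forall x : J, (V *m ract M x <= V)%MS.

Definition module_hom M N (f : 'M[F]_(rdim M, rdim N)) : Prop :=
  forall x : J, ract M x *m f = f *m ract N x.

Definition simple_module S : Prop :=
  (0 < rdim S)%N /\
  forall V : 'M[F]_(rdim S), submodule V -> V = 0 \/ row_full V.

Definition concentrated_at (i : vertex Q) M : Prop := ract M (jidem W i) = 1%:M.

(* Here M, N and I are finite-dimensional.  As the Jacobian algebras considered
   below are finite-dimensional, a finite-dimensional I which is injective in
   this sense is also injective among all modules (Baer's criterion). *)
Definition injective_module I : Prop :=
  forall M N (f : 'M[F]_(rdim M, rdim N)) (g : 'M[F]_(rdim M, rdim I)),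
    module_hom f -> row_free f -> module_hom g ->
    exists2 h : 'M[F]_(rdim N, rdim I), module_hom h & f *m h = g.

Definition essential_mono M I (f : 'M[F]_(rdim M, rdim I)) : Prop :=
  [/\ module_hom f, row_free f &
      forall V : 'M[F]_(rdim I), submodule V -> V != 0 -> (V :&: f)%MS != 0].

Definition injective_hull S I : Prop :=
  injective_module I /\ exists f : 'M[F]_(rdim S, rdim I), essential_mono f.

(* The row space V has dimension vector e: dim (V e_j) = e j for all j. *)
Definition has_dim_vector M m (V : 'M[F]_(m, rdim M)) (e : vertex Q -> nat) :=
  [forall j, \rank (V *m ract M (jidem W j)) == e j].

End Modules.

Local Open Scope classical_set_scope.

Section Homology.
Variable R : realType.

Definition std_simplex (n : nat) : set 'rV[R]_n.+1 :=
  [set t | (forall j, 0 <= t 0 j) /\ \sum_j t 0 j = 1].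
Arguments std_simplex : clear implicits.

Definition coface_fun n (i : 'I_n.+2) (t : 'rV[R]_n.+1) : 'rV[R]_n.+2 :=
  \row_j (if unlift i j is Some k then t 0 k else 0).

Lemma coface_subproof n (i : 'I_n.+2) (t : std_simplex n) :
  coface_fun i (val t) \in std_simplex n.+1.
Proof.
have [t0 t1] := set_mem (valP t).
apply/mem_set; split=> [j|]; first by rewrite mxE; case: unliftP.
rewrite (bigD1_ord i) //= mxE unlift_none add0r -[RHS]t1.
by apply: eq_bigr => k _; rewrite mxE liftK.
Qed.

Definition coface n (i : 'I_n.+2) (t : std_simplex n) : std_simplex n.+1 :=
  exist _ (coface_fun i (val t)) (coface_subproof i t).

Lemma coface_fun_continuous n (i : 'I_n.+2) : continuous (@coface_fun n i).
Proof.
move=> t A [P Pt PA]; exists (fun r k => P r (lift i k)).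
  by move=> r k; have := Pt r (lift i k); rewrite mxE liftK !ord1.
move=> u uP; apply: PA => r j; rewrite mxE; case: unliftP => [k ->|->].
  by have := uP r k; rewrite (ord1 r).
by have := nbhs_singleton (Pt r i); rewrite mxE unlift_none.
Qed.

Lemma coface_continuous n (i : 'I_n.+2) : continuous (@coface n i).
Proof.
apply: continuous_comp_initial => t.
apply: (@continuous_comp _ _ _ set_val (@coface_fun n i)).
  exact: initial_continuous.
exact: coface_fun_continuous.
Qed.

HB.instance Definition _ n (i : 'I_n.+2) :=
  isContinuous.Build _ _ (@coface n i) (@coface_continuous n i).

Variable X : topologicalType.

Definition singular_simplex n := continuousType (std_simplex n) X.

Definition face n (i : 'I_n.+2) (s : singular_simplex n.+1) :
  singular_simplex n := s \o @coface n i.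

Definition chain n := malg (singular_simplex n) rat.

Definition boundary n (c : chain n.+1) : chain n :=
  \sum_(s <- msupp c)
    mcoeff s c *:
      \sum_(i < n.+2) (-1) ^+ i *: mkmalgU (face i s) (1 : rat).

Definition is_cycle n : chain n -> Prop :=
  if n is m.+1 then fun c => boundary c = 0 else fun=> True.

Definition is_boundary n (c : chain n) : Prop := exists b, c = boundary b.

(* b is the dimension of H_n(X; rat): some b cycles form a basis of the space
   of cycles modulo the space of boundaries. *)
Definition is_betti n (b : nat) : Prop :=
  exists z : 'I_b -> chain n, (forall k, is_cycle (z k)) /\
    forall c, is_cycle c ->
      exists! a : 'rV[rat]_b, is_boundary (c - \sum_k a 0 k *: z k).

Definition is_euler_char (chi : int) : Prop :=
  exists (b : nat -> nat) (N : nat), [/\ forall n, is_betti n (b n),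
    forall n, (N <= n)%N -> b n = 0%N & chi = \sum_(n < N) (-1) ^+ n * (b n)%:Z].

(* The value 0 is a default only for spaces whose total rational homology is
   infinite-dimensional, which complex projective varieties are not. *)
Definition euler_char : int := xget 0 [set chi | is_euler_char chi].

End Homology.

Section Grassmannian.
Variables (C : numClosedFieldType) (m d : nat).

Definition frames : set 'M[C]_(m, d) := [set A | row_free A].

Definition frame_equiv (A B : frames) : bool := (val A == val B)%MS.

Lemma frame_equiv_class : equiv_class_of frame_equiv.
Proof.
split=> [A|A B|A B D]; rewrite /frame_equiv.
- by rewrite submx_refl.
- by rewrite andbC.
- by move=> /eqmxP AB /eqmxP BD; apply/eqmxP; apply: eqmx_trans AB BD.
Qed.

Canonical frame_equiv_rel := EquivRelPack frame_equiv_class.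

(* The Grassmannian of m-dimensional subspaces of C^d, in the classical
   topology: it is the quotient of the space of m x d matrices of rank m by the
   relation "same row space". *)
Definition grassmannian : topologicalType :=
  quotient_topology {eq_quot frame_equiv}%qT.

Definition frame_of (V : grassmannian) : 'M[C]_(m, d) := val (repr V).

End Grassmannian.

Definition complexes (R : realType) : numClosedFieldType := R[i].

Section FPolynomial.
Variables (R : realType) (Q : quiver).
Local Notation C := (complexes R).
Variables (W : cpalg C Q) (M : rmodule W).

Definition quiver_grassmannian (e : vertex Q -> nat) :
    set (grassmannian C (\sum_j e j)%N (rdim M)) :=
  [set V | submodule (frame_of V) /\ has_dim_vector (frame_of V) e].

Arguments quiver_grassmannian : clear implicits.

(* cmonom T is the type of commutative monomials in variables indexed by T, so
   this is the ring of polynomials over int in the variables y_j. *)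
Definition ypoly := malg (cmonom (vertex Q)) int.

Definition yvar (j : vertex Q) : ypoly := mkmalgU (ucm j) 1.

(* Only finitely many e matter, since e j <= dim M. *)
Definition F_polynomial : ypoly :=
  \sum_(e : {ffun vertex Q -> 'I_(rdim M).+1})
    (euler_char R (set_type (quiver_grassmannian (fun j => e j)))) *:
      \prod_j yvar j ^+ e j.

End FPolynomial.

Section Rectangle.
Variables (n k : nat).

(* The vertex (p, q), 1 <= p <= n - k - 1 and 1 <= q <= k - 1, is represented
   by (p - 1, q - 1). *)
Definition rect_vertex : finType := ('I_(n - k - 1) * 'I_(k - 1))%type.

Definition is_a (u v : rect_vertex) :=
  (v.1 == u.1.+1 :> nat) && (v.2 == u.2 :> nat).
Definition is_b (u v : rect_vertex) :=
  (v.1 == u.1 :> nat) && (v.2 == u.2.+1 :> nat).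
Definition is_c (u v : rect_vertex) :=
  (u.1 == v.1.+1 :> nat) && (u.2 == v.2.+1 :> nat).

(* There is at most one arrow from u to v, represented by (u, v). *)
Definition rect_arrow : finType :=
  {uv : rect_vertex * rect_vertex |
    [|| is_a uv.1 uv.2, is_b uv.1 uv.2 | is_c uv.1 uv.2]}.

Definition rect_quiver : quiver :=
  @Quiver rect_vertex rect_arrow (fun a => (val a).1) (fun a => (val a).2).

Definition arrow_a : {pred rect_arrow} := fun x => is_a (val x).1 (val x).2.
Definition arrow_b : {pred rect_arrow} := fun x => is_b (val x).1 (val x).2.
Definition arrow_c : {pred rect_arrow} := fun x => is_c (val x).1 (val x).2.

Variable F : fieldType.

(* cpa_path _ u [:: z; y; x] is the path following x, then y, then z; it is 0
   if these arrows cannot be composed. *)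
Definition rect_potential : cpalg F rect_quiver :=
  let cycle3 (x y z : arrow rect_quiver) : cpalg F rect_quiver :=
    if tgt z == src x then cpa_path F (src x) [:: z; y; x] else 0 in
  \sum_(a in arrow_a) \sum_(b in arrow_b) \sum_(c in arrow_c) cycle3 a b c
  - \sum_(a in arrow_a) \sum_(b in arrow_b) \sum_(c in arrow_c) cycle3 b a c.

End Rectangle.
Arguments rect_potential : clear implicits.

(* Main.v *)
From HB Require Import structures.
Require Import Defs.
From mathcomp Require Import all_boot all_order all_algebra.
From mathcomp Require Import all_classical all_reals topology.
From mathcomp Require Import -(notations) finmap.
From mathcomp Require Import -(notations) monalg.
From mathcomp Require Import zify.

Set Implicit Arguments.
Unset Strict Implicit.
Unset Printing Implicit Defensive.

Import GRing.Theory Num.Theory.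
Local Open Scope ring_scope.

(** Every quiver Grassmannian of [I_i] is empty or a single point; hence its
    Euler characteristic is 0 or 1, and so is every coefficient of the
    F-polynomial, distinct dimension vectors having distinct monomials.

    Let [A], [B], [C] be the elements of [J] that are the sums of all arrows of
    type a, b and c.  The cyclic derivatives of the potential, summed over all
    arrows of one type, are up to sign the commutators of the other two sums
    (lemma [sum_cyclic_derivative]): a path made of two arrows of different
    types always has an arrow of the third type that closes it to a 3-cycle,
    also along the boundary of the rectangle.  So [A], [B] and [C] commute.
    They are nilpotent, since a path with only arrows of one type leaves the
    rectangle within [n] steps.  Therefore [J e_i] is spanned by the monomials
    [A^al B^be C^ga e_i] (lemma [jmon_generate]).  Such a monomial, if it is not
    zero, ends at a vertex [j] that determines [al - ga] and [be - ga]; so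
    [e_j J e_i] is spanned by the multiples [U^t m_j] of a single monomial [m_j]
    by powers of the central nilpotent element [U = ABC].

    Being an essential extension of a simple module at [i], the module [I_i]
    has a linear form which vanishes on [v J], for [v] in [I_i], only if
    [v = 0], and which factors through [e_i] (lemma [essential_separated]).
    If [v] lies in [I_i e_j] and [v U = 0], then all values of the form on
    [v J] are determined by the value at [v m_j]; so the kernel of the nilpotent
    map [U] on [I_i e_j] has dimension at most 1 (lemma [cycle_ker_rank]), and
    the only [U]-stable subspace of dimension [r] of [I_i e_j], if there is one,
    is the kernel of [U^r].  A submodule is the sum of its components at the
    vertices, and is therefore determined by its dimension vector (lemma
    [submodule_dim_vector]). *)

(** * Homology of the empty space and of a point *)

Section SmallHomology.
Variables (R : realType) (X : topologicalType).

Lemma boundary0 n : boundary (0 : chain R X n.+1) = 0.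
Proof. by rewrite /boundary msupp0 big_nil. Qed.

Lemma is_boundary0 n : is_boundary (0 : chain R X n).
Proof. by exists 0; rewrite boundary0. Qed.

(** The hypothesis says that all cycles are boundaries, in a form which spares
    the linearity of the boundary operator.  A positive [b] is then excluded
    because the coordinates of the cycle 0 are not unique. *)
Lemma is_betti_exact n :
  (forall b (z : 'I_b -> chain R X n) (a : 'rV[rat]_b) c,
     (forall k, is_cycle (z k)) -> is_cycle c ->
     is_boundary (c - \sum_k a 0 k *: z k)) ->
  forall b, is_betti R X n b <-> b = 0%N.
Proof.
move=> exact_n b; split=> [[z [zc zb]]|->]; last first.
  exists (fun=> 0); split=> [[]//|c c_cycle]; exists 0; split=> [|a _].
    by apply: exact_n => // -[].
  by apply/rowP => -[].
have cycle0 : is_cycle (0 : chain R X n).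
  by case: n {exact_n zb z zc} => //= n; exact: boundary0.
have [a [_ a_uniq]] := zb _ cycle0.
have aE d : d = a by apply/esym/a_uniq/exact_n.
case: b z zc zb a a_uniq aE => // b _ _ _ a _ aE.
have /matrixP/(_ 0 0) : const_mx 0 = const_mx 1 :> 'rV[rat]_b.+1.
  by rewrite (aE (const_mx 0)).
by rewrite !mxE => /eqP; rewrite eq_sym oner_eq0.
Qed.

Lemma is_betti_cycle0 n : (forall c : chain R X n, is_cycle c -> c = 0) ->
  forall b, is_betti R X n b <-> b = 0%N.
Proof.
move=> c0; apply: is_betti_exact => b z a c zc /c0 ->.
rewrite big1 => [|k _]; last by rewrite (c0 _ (zc k)) scaler0.
by rewrite subr0; exact: is_boundary0.
Qed.

Lemma std_simplex_vertex n : @std_simplex R n.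
Proof.
exists (\row_j (j == ord0)%:R); apply/mem_set; split=> [j|].
  by rewrite mxE ler0n.
rewrite (bigD1 ord0) //= mxE eqxx big1 ?addr0 // => j /negPf j0.
by rewrite mxE j0.
Qed.

Lemma euler_char_empty : (X -> False) -> euler_char R X = 0.
Proof.
move=> X0; have betti0 n : forall b, is_betti R X n b <-> b = 0%N.
  apply: is_betti_cycle0 => c _; apply/malgP => s.
  by case: (X0 (s (std_simplex_vertex n))).
apply: xget_unique => [|chi].
  by exists (fun=> 0%N), 0%N; split=> [n|//|]; [apply/betti0|rewrite big_ord0].
move=> [b [N [bP _ ->]]]; rewrite big1 // => n _.
by rewrite (_ : b n = 0%N) ?mulr0 //; apply/betti0.
Qed.

Section Point.
Variables (pt : X) (ptP : forall x : X, x = pt).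

Definition const_simplex n : singular_simplex R X n := cst pt.

Lemma singular_simplex_point n (s : singular_simplex R X n) :
  s = const_simplex n.
Proof. by apply/continuousEP => t; rewrite [LHS]ptP [RHS]ptP. Qed.

Lemma chain_point n (c : chain R X n) :
  c = mkmalgU (const_simplex n) (mcoeff (const_simplex n) c).
Proof.
by apply/malgP => s; rewrite (singular_simplex_point s) mcoeffUU.
Qed.

(** All faces of a simplex coincide, so the boundary is the alternating sum of
    [n + 2] ones: 1 for [n] odd and 0 for [n] even. *)
Lemma boundary_point n (c : chain R X n.+1) :
  boundary c = mkmalgU (const_simplex n)
    ((odd n)%:R * mcoeff (const_simplex n.+1) c).
Proof.
rewrite {1}[c]chain_point; set x := mcoeff _ c.
have -> : boundary (mkmalgU (const_simplex n.+1) x : chain R X n.+1) =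
    x *: \sum_(i < n.+2) (-1) ^+ i *: mkmalgU (const_simplex n) (1 : rat).
  rewrite /boundary msuppU; case: eqP => [->|_].
    by rewrite big_nil scale0r.
  rewrite finmap.big_seq_fset1 mcoeffUU; congr (_ *: _); apply: eq_bigr => i _.
  by rewrite (singular_simplex_point (face _ _)).
apply/malgP => s; rewrite (singular_simplex_point s) mcoeffZ mcoeffUU mulrC.
rewrite -scaler_suml mcoeffZ mcoeffUU mulr1; congr (_ * _).
elim: n {s x c} => [|n IHn].
  by rewrite !big_ord_recr big_ord0 /= add0r subrr.
by rewrite big_ord_recr /= IHn -signr_odd /=; case: odd; rewrite ?subrr ?add0r.
Qed.

Lemma is_betti_point0 b : is_betti R X 0 b <-> b = 1%N.
Proof.
have boundary0P (c : chain R X 0) : is_boundary c <-> c = 0.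
  split=> [[d ->]|->]; last exact: is_boundary0.
  by rewrite boundary_point mul0r monalgU0.
pose s := const_simplex 0.
split=> [[z [_ zb]]|->]; last first.
  exists (fun=> mkmalgU s 1); split=> // c _.
  have cE (a : 'rV[rat]_1) :
      is_boundary (c - \sum_k a 0 k *: mkmalgU s (1 : rat)) <->
      a 0 0 = mcoeff s c.
    rewrite boundary0P big_ord1; split=> [/(congr1 (mcoeff s))|aE].
      by rewrite mcoeffB mcoeffZ mcoeffUU mcoeff0 mulr1 => /subr0_eq ->.
    apply/malgP => t; rewrite (singular_simplex_point t) mcoeffB mcoeffZ.
    by rewrite mcoeffUU aE mulr1 subrr mcoeff0.
  exists (const_mx (mcoeff s c)); split=> [|a]; first by rewrite cE mxE.
  by rewrite cE => aE; apply/rowP => j; rewrite !ord1 mxE aE.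
pose Z : 'cV[rat]_b := \col_k mcoeff s (z k).
have zE (a : 'rV[rat]_b) c :
    is_boundary (c - \sum_k a 0 k *: z k) <-> (a *m Z) 0 0 = mcoeff s c.
  rewrite boundary0P mxE (_ : \sum__ _ = mcoeff s (\sum_k a 0 k *: z k)).
    split=> [/(congr1 (mcoeff s))|aE].
      by rewrite mcoeffB mcoeff0 => /subr0_eq ->.
    apply/malgP => t.
    by rewrite (singular_simplex_point t) mcoeffB aE subrr mcoeff0.
  rewrite [RHS](raddf_sum (mcoeff s)); 
  by apply: eq_bigr => k _; rewrite [RHS]mcoeffZ mxE.
(* Uniqueness of the coordinates gives b <= 1, and their existence b >= 1. *)
have Zfree : row_free Z.
  rewrite -kermx_eq0; apply/rowV0P => a /sub_kermxP aZ.
  have [a0 [_ a_uniq]] := zb 0 I.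
  rewrite -(a_uniq 0) ?(a_uniq a) // zE ?aZ ?mul0mx mcoeff0 mxE //.
have Z0 : Z != 0.
  have [a [/zE aE _]] := zb (mkmalgU s 1) I.
  apply/eqP => Z0; move: aE; rewrite Z0 mulmx0 mcoeffUU mxE => /eqP.
  by rewrite eq_sym oner_eq0.
rewrite -mxrank_eq0 in Z0; move/eqP: Zfree => Zb; move: Z0 (rank_leq_col Z).
by rewrite Zb; case: (b) => [|[|]].
Qed.

Lemma is_betti_pointS n b : is_betti R X n.+1 b <-> b = 0%N.
Proof.
have [on|en] := boolP (odd n).
  apply: is_betti_cycle0 => c /= c0; rewrite [c]chain_point.
  move/(congr1 (mcoeff (const_simplex n))): c0.
  by rewrite boundary_point mcoeffUU on mul1r mcoeff0 => ->; rewrite monalgU0.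
apply: is_betti_exact => b' z a c0 _ _; move: (c0 - _) => c.
exists (mkmalgU (const_simplex n.+2) (mcoeff (const_simplex n.+1) c)).
by rewrite boundary_point mcoeffUU /= en mul1r -chain_point.
Qed.

Lemma euler_char_point : euler_char R X = 1.
Proof.
apply: xget_unique => [|chi].
  exists (fun n => nat_of_bool (n == 0%N)), 1%N; split.
  - by case=> [|n]; [apply/is_betti_point0|apply/is_betti_pointS].
  - by case.
  - by rewrite big_ord1.
move=> [b [N [bP b0 ->]]].
have b1 : b 0%N = 1%N by apply/is_betti_point0.
case: N b0 => [/(_ 0%N)|N _]; first by rewrite b1 => /(_ isT).
rewrite big_ord_recl b1 big1 ?addr0 // => n _.
by rewrite (_ : b _ = 0%N) ?mulr0 //; apply/(is_betti_pointS n).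
Qed.

End Point.
End SmallHomology.

(** * Sums of arrows in the completed path algebra *)

Section ArrowSums.
Variables (F : fieldType) (Q : quiver).
Implicit Types (P : {pred arrow Q}) (x y : cpalg F Q) (p : qpath Q).

Definition arrow_sum P : cpalg F Q :=
  fun p => if parr p is [:: z] then (z \in P)%:R else 0 : F.

Lemma arrow_sumM P x p : (arrow_sum P * x) p =
  if parr p is z :: _ then (z \in P)%:R * (x (pdrop 1 p) : F) else 0.
Proof.
transitivity (\sum_(l < (size (parr p)).+1)
    (if take l (parr p) is [:: z] then (z \in P)%:R else 0 : F) *
    (x (pdrop l p) : F)); first by [].
case: (parr p) => [|z s] /=; first by rewrite big_ord1 mul0r.
rewrite 2!big_ord_recl /= mul0r add0r take0 big1 ?addr0 // => l _.
by case: s l => [[]|y s l] //=; rewrite mul0r.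
Qed.

Lemma qpath_val p : val p = (psrc p, parr p).
Proof. by case: p => -[]. Qed.

Lemma cpa_idemM i x p : (cpa_idem F i * x) p = (ptgt p == i)%:R * (x p : F).
Proof.
transitivity (\sum_(l < (plen p).+1)
    ((val (ptake l p) == (i, [::]))%:R : F) * (x (pdrop l p) : F)).
  by [].
have pd0 : pdrop 0 p = p by apply: qpath_eq; rewrite !pathE ?drop0.
rewrite big_ord_recl pd0 big1 ?addr0 => [|l _].
  by rewrite /= take0 drop0 xpair_eqE /= andbT.
rewrite xpair_eqE /= /bump /= add1n.
have : (l < size (parr p))%N := ltn_ord l.
by case: (parr p) => //= *; rewrite andbF mul0r.
Qed.

Lemma cpaM_idem i x p : (x * cpa_idem F i) p = (x p : F) * (psrc p == i)%:R.
Proof.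
transitivity (\sum_(l < (plen p).+1)
    (x (ptake l p) : F) * (val (pdrop l p) == (i, [::]))%:R).
  by [].
have pd0 : ptake (plen p) p = p.
  by apply: qpath_eq; rewrite !pathE ?take_size // drop_size.
rewrite big_ord_recr /= pd0 big1 ?add0r => [|l _].
  by rewrite /= drop_size xpair_eqE /= andbT.
rewrite xpair_eqE /= -size_eq0 size_drop subn_eq0.
by rewrite leqNgt ltn_ord andbF mulr0.
Qed.

Lemma cpa_subE x y p : (x - y) p = (x p : F) - (y p : F).
Proof. by []. Qed.

Lemma cpa_sumE (I : Type) (r : seq I) (D : pred I) (f : I -> cpalg F Q) p :
  (\sum_(i <- r | D i) f i) p = \sum_(i <- r | D i) (f i p : F).
Proof. by apply: (big_morph (fun x : cpalg F Q => x p : F)). Qed.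

Lemma cpa_sum3E (I : finType) (A B C : {pred I})
    (f : I -> I -> I -> cpalg F Q) p :
  (\sum_(a in A) \sum_(b in B) \sum_(c in C) f a b c) p =
  \sum_(a in A) \sum_(b in B) \sum_(c in C) (f a b c p : F).
Proof.
rewrite cpa_sumE; apply: eq_bigr => a _.
rewrite cpa_sumE; apply: eq_bigr => b _; exact: cpa_sumE.
Qed.

Lemma cpa_cycleE p (z y x z' y' x' : arrow Q) :
  parr p = [:: z; y; x] -> tgt z = src x ->
  (if tgt z' == src x' then cpa_path F (src x') [:: z'; y'; x'] else 0) p =
  ((x' == x) && (y' == y) && (z' == z))%:R :> F.
Proof.
move=> pE zx; have px : psrc p = src x.
  by have := valP p; rewrite qpath_val pE /= andbT => /and3P[_ _ /eqP].
case: ifP => [_|zx'].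
  rewrite /cpa_path qpath_val pE px xpair_eqE !eqseq_cons andbT.
  rewrite [z' == z]eq_sym [y' == y]eq_sym [x' == x]eq_sym.
  case: (x =P x') => [->|]; rewrite ?eqxx ?andbF //=.
  by rewrite andbT andbC.
case: (x' =P x) => [xx|_]; case: (z' =P z) => [zz|_]; rewrite ?andbF //.
by rewrite xx zz zx eqxx in zx'.
Qed.

Lemma cpa_idem_sum : \sum_i cpa_idem F i = 1 :> cpalg F Q.
Proof.
apply/funext => p; rewrite cpa_sumE.
rewrite (bigD1 (psrc p)) //= big1 ?addr0 => [|i /negPf ip].
  by rewrite /cpa_idem /cpa_path qpath_val xpair_eqE eqxx -size_eq0.
by rewrite /cpa_idem /cpa_path qpath_val xpair_eqE eq_sym ip.
Qed.

Lemma cpa_scale_idemE (a : F) i p :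
  (a *: cpa_idem F i) p = a * ((psrc p == i) && (parr p == [::]))%:R.
Proof. by rewrite -xpair_eqE -qpath_val. Qed.

(** For deterministic [P], the coefficient of [left_quotient P x] at a path [p]
    is that of [x] at the path [z p], where [z] is the arrow in [P] which can
    follow [p]. *)
Definition left_quotient P x : cpalg F Q :=
  fun p => \sum_(z in P) cpa_coef x (psrc p) (z :: parr p).

Definition deterministic P :=
  {in P &, forall y z : arrow Q, src y = src z -> y = z}.

Lemma left_quotientK P x p z : deterministic P -> ohead (parr p) = Some z ->
  (arrow_sum P * left_quotient P x) p = (z \in P)%:R * (x p : F).
Proof.
move=> Pdet; rewrite arrow_sumM; case ps: (parr p) => [|y s] //= [yz].
rewrite {y}yz in ps *.
have [zP|] := boolP (z \in P); rewrite ?mul0r // !mul1r /left_quotient.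
have := valP p; rewrite qpath_val ps => /= /andP[/eqP zs s_path].
rewrite !pathE ps /= drop0 (bigD1 z) //= big1 ?addr0 => [|y /andP[yP yz]].
  rewrite /cpa_coef; case: insubP => [q _ qE|/negP[]]; last first.
    by rewrite /= zs eqxx.
  by congr x; apply: val_inj; rewrite qE qpath_val ps.
rewrite /cpa_coef; case: insubP => // q /= /andP[/eqP yE _] _.
by case/eqP: yz; apply: Pdet => //; rewrite yE.
Qed.

End ArrowSums.

(** * Commutators as sums of cyclic derivatives *)

Section CyclicDerivative.
Variables (n k : nat) (F : fieldType).
Local Notation Q := (rect_quiver n k).
Local Notation W := (rect_potential n k F).
Local Notation arrow := (arrow Q).

(** The coefficient of the potential at the 3-cycle that follows [x], [y], [z]
    in this order; the last arrow of each chosen representative is of type c. *)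
Definition cycle_sign (z y x : arrow) : F :=
  ((x \in arrow_a (k:=k)) && (y \in arrow_b (k:=k)))%:R *
    (z \in arrow_c (k:=k))%:R -
  ((x \in arrow_b (k:=k)) && (y \in arrow_a (k:=k)))%:R *
    (z \in arrow_c (k:=k))%:R.

Lemma sum_indicator3 (A B C : {pred arrow}) (x y z : arrow) :
  \sum_(a in A) \sum_(b in B) \sum_(c in C)
    ((a == x) && (b == y) && (c == z))%:R
  = ((x \in A) && (y \in B))%:R * (z \in C)%:R :> F.
Proof.
have sum1 (P : {pred arrow}) t (g : F) :
    \sum_(a in P) (a == t)%:R * g = (t \in P)%:R * g.
  rewrite -mulr_suml; congr (_ * _); have [tP|tP] := boolP (t \in P).
    by rewrite (bigD1 t) //= eqxx big1 ?addr0 // => a /andP[_ /negPf ->].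
  by rewrite big1 // => a aP; case: eqP tP => // <-; rewrite aP.
under eq_bigr => a _ do under eq_bigr => b _ do
  under eq_bigr => c _ do rewrite -mulnb -mulnb !natrM mulrC.
under eq_bigr => a _ do under eq_bigr => b _ do rewrite sum1 mulrC -mulrA.
under eq_bigr => a _ do rewrite -mulr_sumr sum1.
by rewrite sum1 mulrA -natrM mulnb.
Qed.

Lemma rect_potential_size (p : qpath Q) : plen p != 3 -> W p = 0.
Proof.
move=> p3; have path0 i z y x : cpa_path F i [:: z; y; x] p = 0.
  rewrite /cpa_path qpath_val xpair_eqE; case: (parr p =P _) => [pE|].
    by rewrite /plen pE in p3.
  by rewrite andbF.
rewrite /rect_potential cpa_subE [X in X - _]cpa_sum3E [X in _ - X]cpa_sum3E.
rewrite [X in X - _]big1 => [|a _]; last first.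
  rewrite big1 // => b _; rewrite big1 // => c _.
  by case: ifP => [_|_]; [exact: path0|].
rewrite [X in _ - X]big1 ?subrr // => a _.
rewrite big1 // => b _; rewrite big1 // => c _.
by case: ifP => [_|_]; [exact: path0|].
Qed.

Lemma rect_potential_cycle (p : qpath Q) z y x :
  parr p = [:: z; y; x] -> tgt z = src x -> W p = cycle_sign z y x.
Proof.
move=> pE zx.
have pathE' z' y' x' := cpa_cycleE F z' y' x' pE zx.
rewrite /rect_potential cpa_subE [X in X - _]cpa_sum3E [X in _ - X]cpa_sum3E.
rewrite /cycle_sign; congr (_ - _).
  rewrite -sum_indicator3.
  by do 3!apply: eq_bigr => ? _; rewrite pathE'.
rewrite exchange_big -sum_indicator3.
by do 3!apply: eq_bigr => ? _; rewrite pathE'.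
Qed.

Lemma cyclic_derivative_size al (p : qpath Q) :
  plen p != 2 -> cyclic_derivative al W p = 0.
Proof.
move=> p2; rewrite /cyclic_derivative; case: ifP => // _.
apply: big1 => l _; rewrite /cpa_coef; case: insubP => // q _ qE.
apply: rect_potential_size; rewrite /plen /parr qE /= size_cat /= addnS.
by rewrite addnC -size_cat cat_take_drop eqSS.
Qed.

(** The three summands are the three cyclic rotations of the cycle that [al]
    closes. *)
Lemma cyclic_derivative_cycle al (p : qpath Q) y x :
  parr p = [:: y; x] -> cyclic_derivative al W p =
  if (tgt y == src al) && (src x == tgt al) then
    cycle_sign y x al + cycle_sign x al y + cycle_sign al y x else 0.
Proof.
move=> pE; have := valP p.
rewrite qpath_val pE [is_path _ _]/= andbT => /andP[/eqP yx /eqP px].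
rewrite /cyclic_derivative /ptgt /plen pE [endpoint _ _]/= -px andbC.
case: ifP => // /andP[/eqP yal /eqP xal].
have coefE i z' y' x' : is_path i [:: z'; y'; x'] -> tgt z' = src x' ->
    cpa_coef W i [:: z'; y'; x'] = cycle_sign z' y' x'.
  move=> ip zx; rewrite /cpa_coef insubT /=.
  exact: rect_potential_cycle.
rewrite !big_ord_recl big_ord0 addr0 addrA !pathE pE /=.
rewrite !coefE //= ?yal ?xal ?yx ?eqxx //.
by rewrite -xal px eqxx.
Qed.

(** An arrow is determined by its ends, so at most one summand is not zero. *)
Lemma sum_closing_arrow (r : rel (rect_vertex n k)) u v (g : F) :
  (forall u v, r u v -> [|| is_a u v, is_b u v | is_c u v]) ->
  (g != 0 -> r u v) ->
  \sum_(al : arrow | r (src al) (tgt al))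
     (if (u == src al) && (v == tgt al) then g else 0) = g.
Proof.
move=> rP; have [->|_ /(_ isT) ruv] := eqVneq g 0.
  by rewrite big1 // => al _; rewrite if_same.
pose al : arrow := exist _ (u, v) (rP u v ruv).
rewrite (bigD1 al) //= !eqxx big1 ?addr0 // => be /andP[_].
case: be => -[u' v'] uv' /=; rewrite -val_eqE /= xpair_eqE.
by rewrite [u' == u]eq_sym [v' == v]eq_sym => /negPf ->.
Qed.

(** A path of length 2 with one arrow in [A] and one in [B] is always closed to
    a 3-cycle by an arrow in [D], even on the boundary of the rectangle; so each
    term of the commutator comes from exactly one cyclic derivative. *)
Lemma sum_cyclic_derivative (D : {pred arrow}) (r : rel (rect_vertex n k))
    (A B : {pred arrow}) :
  (forall u v, r u v -> [|| is_a u v, is_b u v | is_c u v]) ->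
  (forall al, (al \in D) = r (src al) (tgt al)) ->
  (forall al y x, al \in D ->
     cycle_sign y x al + cycle_sign x al y + cycle_sign al y x =
     ((y \in B) && (x \in A))%:R - ((y \in A) && (x \in B))%:R) ->
  (forall x y, x \in A -> y \in B -> src y = tgt x -> r (tgt y) (src x)) ->
  (forall x y, x \in B -> y \in A -> src y = tgt x -> r (tgt y) (src x)) ->
  arrow_sum F B * arrow_sum F A - arrow_sum F A * arrow_sum F B =
  \sum_(al in D) 1 * cyclic_derivative al W * 1.
Proof.
move=> rP rD sgnE AB BA; apply/funext => p.
rewrite cpa_sumE cpa_subE !arrow_sumM.
under eq_bigr => al _ do rewrite mul1r mulr1.
case pE: (parr p) => [|y [|x s]].
- rewrite subrr big1 // => al _; apply: cyclic_derivative_size.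
  by rewrite /plen pE.
- rewrite /arrow_sum pathE pE /= !mulr0 subrr big1 // => al _.
  by apply: cyclic_derivative_size; rewrite /plen pE.
have /eqP yx : src y == tgt x.
  by have := valP p; rewrite qpath_val pE => /andP[].
rewrite /arrow_sum pathE pE /=; case: s pE => [|z s] pE; last first.
  rewrite !mulr0 subrr big1 // => al _.
  by apply: cyclic_derivative_size; rewrite /plen pE.
rewrite -!natrM !mulnb.
transitivity (\sum_(al : arrow | r (src al) (tgt al))
  (if (tgt y == src al) && (src x == tgt al) then
     ((y \in B) && (x \in A))%:R - ((y \in A) && (x \in B))%:R : F else 0)).
  rewrite sum_closing_arrow //.
  case: (boolP (_ && _)) => [/andP[yB xA] _|_]; first exact: AB.
  case: (boolP (_ && _)) => [/andP[yA xB] _|_]; first exact: BA.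
  by rewrite subrr eqxx.
apply: eq_big => [al|al ral]; first by rewrite rD.
rewrite (cyclic_derivative_cycle _ pE); case: ifP => // _.
by rewrite sgnE // rD.
Qed.

End CyclicDerivative.

(** * The rectangular Jacobian algebra *)

Section JacobianProjection.
Variables (F : fieldType) (Q : quiver) (W : cpalg F Q).

Lemma jpi_is_zmod_morphism : zmod_morphism (jpi W).
Proof. by move=> x y; apply/(addIr (jpi W y)); rewrite -jpiD !subrK. Qed.

Lemma jpi_is_monoid_morphism : monoid_morphism (jpi W).
Proof. by split=> // x y; exact: jpiM. Qed.

HB.instance Definition _ := GRing.isZmodMorphism.Build
  (cpalg F Q) (jacobian_algebra W) (jpi W) jpi_is_zmod_morphism.
HB.instance Definition _ := GRing.isMonoidMorphism.Build
  (cpalg F Q) (jacobian_algebra W) (jpi W) jpi_is_monoid_morphism.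

Lemma jpi_eq_ideal x y : jacobian_ideal W (x - y) -> jpi W x = jpi W y.
Proof. by move=> Wxy; apply/jpiP/asboolP => N; exists (x - y). Qed.

Lemma jidem_sum : \sum_i jidem W i = 1.
Proof. by rewrite -[LHS](raddf_sum (jpi W)) cpa_idem_sum. Qed.

Lemma jscaleAr (a : F) (x y : jacobian_algebra W) : x * (a *: y) = a *: (x * y).
Proof.
suff: jmul (jpi W (repr x)) (jscale a (jpi W (repr y))) =
  jscale a (jmul (jpi W (repr x)) (jpi W (repr y))) by rewrite !jpiK.
by rewrite -jpiZ -!jpiM -jpiZ cpa_scaleAr.
Qed.

Lemma jidemK i : jidem W i * jidem W i = jidem W i.
Proof.
rewrite -rmorphM; congr (jpi W _); apply/funext => p.
rewrite cpa_idemM /cpa_idem /cpa_path qpath_val xpair_eqE /ptgt.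
case: (parr p) => [|z s]; rewrite /= ?andbF ?mulr0 // andbT.
by case: eqP; rewrite ?mulr1 ?mulr0.
Qed.

End JacobianProjection.

Section RectangleAlgebra.
Variables (n k : nat) (F : fieldType).
Local Notation Q := (rect_quiver n k).
Local Notation W := (rect_potential n k F).
Local Notation J := (jacobian_algebra W).
Local Notation Pa := (arrow_a (n:=n) (k:=k) : {pred arrow Q}).
Local Notation Pb := (arrow_b (n:=n) (k:=k) : {pred arrow Q}).
Local Notation Pc := (arrow_c (n:=n) (k:=k) : {pred arrow Q}).
Local Notation sa := (arrow_sum F Pa).
Local Notation sb := (arrow_sum F Pb).
Local Notation sc := (arrow_sum F Pc).

Definition ja : J := jpi W sa.
Definition jb : J := jpi W sb.
Definition jc : J := jpi W sc.

Lemma in_arrow_a (z : arrow Q) : (z \in Pa) = is_a (src z) (tgt z).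
Proof. by []. Qed.
Lemma in_arrow_b (z : arrow Q) : (z \in Pb) = is_b (src z) (tgt z).
Proof. by []. Qed.
Lemma in_arrow_c (z : arrow Q) : (z \in Pc) = is_c (src z) (tgt z).
Proof. by []. Qed.
Definition in_arrowE := (in_arrow_a, in_arrow_b, in_arrow_c).

Lemma arrow_typeP (z : arrow Q) :
  [\/ [/\ z \in Pa, z \notin Pb & z \notin Pc],
      [/\ z \notin Pa, z \in Pb & z \notin Pc] |
      [/\ z \notin Pa, z \notin Pb & z \in Pc]].
Proof.
rewrite !in_arrowE; case: z => -[u v] /=.
rewrite /is_a /is_b /is_c /=.
case: u v => [u1 u2] [v1 v2] /= uv.
have [?|] := boolP ((v1 == u1.+1 :> nat) && (v2 == u2 :> nat)).
  by constructor 1; split; lia.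
have [? ?|? ?] := boolP ((v1 == u1 :> nat) && (v2 == u2.+1 :> nat)).
  by constructor 2; split; lia.
by constructor 3; split=> //; lia.
Qed.

Lemma commute_of_derivative (D : {pred arrow Q}) (x y : cpalg F Q) :
  x * y - y * x = \sum_(al in D) 1 * cyclic_derivative al W * 1 ->
  jpi W x * jpi W y = jpi W y * jpi W x.
Proof.
move=> xy; rewrite -!rmorphM; apply: jpi_eq_ideal; rewrite xy.
exists [seq (1, al, 1) | al <- enum D].
by rewrite big_map big_enum.
Qed.

Lemma jab_comm : GRing.comm ja jb.
Proof.
apply/commr_sym.
apply: (@commute_of_derivative Pc).
apply: (@sum_cyclic_derivative n k F _ (@is_c n k)) => //.
- by move=> u v ->; rewrite !orbT.
- move=> al y x.
  have [[_ _ /negPf->]|[_ _ /negPf->]|[/negPf ala /negPf alb alc] _] // :=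
    arrow_typeP al.
  rewrite /cycle_sign ala alb alc /= !andbF /= !mul0r !mulr1 subrr !add0r.
  by rewrite andbC [(y \in arrow_a (k:=k)) && _]andbC.
- move=> x y; rewrite !in_arrowE /is_a /is_b /is_c => xa yb yx.
  by rewrite yx in yb; lia.
- move=> x y; rewrite !in_arrowE /is_a /is_b /is_c => xa yb yx.
  by rewrite yx in yb; lia.
Qed.

Lemma jbc_comm : GRing.comm jb jc.
Proof.
apply/commr_sym.
apply: (@commute_of_derivative Pa).
apply: (@sum_cyclic_derivative n k F _ (@is_a n k)) => //.
- by move=> u v ->.
- move=> al y x.
  have [[ala /negPf alb /negPf alc _]|[/negPf-> _ _]|[/negPf-> _ _]] // :=
    arrow_typeP al.
  rewrite /cycle_sign ala alb alc /= !andbF andbT !mul0r !mulr0 !subr0 addr0.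
  by rewrite sub0r -!natrM !mulnb [(x \in _) && _]andbC.
- move=> x y; rewrite !in_arrowE /is_a /is_b /is_c => xa yb yx.
  by rewrite yx in yb; lia.
- move=> x y; rewrite !in_arrowE /is_a /is_b /is_c => xa yb yx.
  by rewrite yx in yb; lia.
Qed.

Lemma jac_comm : GRing.comm ja jc.
Proof.
apply: (@commute_of_derivative Pb).
apply: (@sum_cyclic_derivative n k F _ (@is_b n k)) => //.
- by move=> u v ->; rewrite orbT.
- move=> al y x.
  have [[_ /negPf-> _]|[/negPf ala alb /negPf alc _]|[_ /negPf-> _]] // :=
    arrow_typeP al.
  rewrite /cycle_sign ala alb alc /= !andbF andbT !mul0r !mulr0 !subr0 addr0.
  by rewrite sub0r -!natrM !mulnb addrC [(x \in _) && _]andbC.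
- move=> x y; rewrite !in_arrowE /is_a /is_b /is_c => xa yb yx.
  by rewrite yx in yb; lia.
- move=> x y; rewrite !in_arrowE /is_a /is_b /is_c => xa yb yx.
  by rewrite yx in yb; lia.
Qed.

(** Every path in the support of [x] moves by [(al - ga, be - ga)]; the
    equations avoid truncated subtraction. *)
Definition displaces (al be ga : nat) (x : cpalg F Q) :=
  forall p : qpath Q, x p != 0 ->
    ((ptgt p).1 + ga = (psrc p).1 + al)%N /\
    ((ptgt p).2 + ga = (psrc p).2 + be)%N.

Lemma displacesM al be ga al' be' ga' x y :
  displaces al be ga x -> displaces al' be' ga' y ->
  displaces (al + al') (be + be') (ga + ga') (x * y).
Proof.
move=> dx dy p xyp.
have [l /andP[xl yl]] : exists l, (x (ptake l p) != 0) && (y (pdrop l p) != 0).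
  apply: contrapT => xy0; case/eqP: xyp.
  transitivity (\sum_(l < (plen p).+1)
      (x (ptake l p) : F) * (y (pdrop l p) : F)).
    by [].
  apply: big1 => l _; apply/eqP; rewrite mulf_eq0.
  apply/negPn/negP => xy; apply: xy0; exists l.
  by rewrite -negb_or.
have tgtE : ptgt (ptake l p) = ptgt p.
  rewrite /ptgt !pathE; rewrite -[in RHS](cat_take_drop l (parr p)).
  by case: (take l _).
have [] := dx _ xl; have [] := dy _ yl; rewrite tgtE.
have -> : psrc (ptake l p) = ptgt (pdrop l p) by [].
have -> : psrc (pdrop l p) = psrc p by [].
by move=> ? ? ? ?; split; lia.
Qed.

Lemma displacesX al be ga x m : displaces al be ga x ->
  displaces (al * m) (be * m) (ga * m) (x ^+ m).
Proof.
move=> dx; elim: m => [|m IHm]; last by rewrite exprS !mulnS; exact: displacesM.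
rewrite expr0 !muln0 => p; rewrite /GRing.one /= /cpa_one /plen /ptgt.
by case: (parr p) => //=; rewrite ?eqxx.
Qed.

Lemma arrow_sum_displaces al be ga (P : {pred arrow Q}) :
  (forall z, z \in P -> ((tgt z).1 + ga = (src z).1 + al)%N /\
                        ((tgt z).2 + ga = (src z).2 + be)%N) ->
  displaces al be ga (arrow_sum F P).
Proof.
move=> zP p; rewrite /arrow_sum /ptgt; have := valP p; rewrite qpath_val.
case: (parr p) => [|z [|]]; rewrite ?eqxx //= andbT => /eqP <-.
by case: (boolP (z \in P)) => [/zP//|_]; rewrite eqxx.
Qed.

Lemma sa_displaces : displaces 1 0 0 sa.
Proof. apply: arrow_sum_displaces => z; rewrite in_arrowE /is_a; lia. Qed.
Lemma sb_displaces : displaces 0 1 0 sb.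
Proof. apply: arrow_sum_displaces => z; rewrite in_arrowE /is_b; lia. Qed.
Lemma sc_displaces : displaces 0 0 1 sc.
Proof. apply: arrow_sum_displaces => z; rewrite in_arrowE /is_c; lia. Qed.

Lemma monomial_displaces al be ga :
  displaces al be ga (sa ^+ al * sb ^+ be * sc ^+ ga).
Proof.
have := displacesM (displacesM (displacesX (m := al) sa_displaces)
  (displacesX (m := be) sb_displaces)) (displacesX (m := ga) sc_displaces).
by rewrite !mul0n !mul1n !add0n !addn0.
Qed.

Definition jmon (al be ga : nat) : J := ja ^+ al * jb ^+ be * jc ^+ ga.

Lemma jmon_displacement (i j : vertex Q) al be ga :
  (j.1 + ga = i.1 + al)%N /\ (j.2 + ga = i.2 + be)%N \/
  jidem W j * jmon al be ga * jidem W i = 0.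
Proof.
have [?|ij] :=
  pselect ((j.1 + ga = i.1 + al)%N /\ (j.2 + ga = i.2 + be)%N); first by left.
right; pose m := sa ^+ al * sb ^+ be * sc ^+ ga.
transitivity (jpi W (cpa_idem F j * m * cpa_idem F i)).
  by rewrite !rmorphM !rmorphXn.
rewrite -[RHS](rmorph0 (jpi W)); congr (jpi W _); apply/funext => p.
rewrite cpaM_idem cpa_idemM; case: eqP => [tp|]; last by rewrite !mul0r.
case: eqP => [sp|]; last by rewrite !mulr0.
rewrite mul1r mulr1; apply/eqP; apply/negPn/negP.
by move/monomial_displaces; rewrite tp sp.
Qed.

(** The element [U = ABC], which commutes with [A], [B], [C] and all [e_j]. *)
Definition jcycle : J := jmon 1 1 1.

Lemma jcycle_idem i : jidem W i * jcycle = jcycle * jidem W i.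
Proof.
pose x := sa ^+ 1 * sb ^+ 1 * sc ^+ 1.
have -> : jcycle = jpi W x by rewrite !rmorphM !rmorphXn.
rewrite -[LHS](rmorphM (jpi W)) -[RHS](rmorphM (jpi W)); congr (jpi W _).
apply/funext => p; rewrite cpaM_idem cpa_idemM mulrC.
have [-> /[!mul0r]//|xp] := eqVneq (x p) 0; congr (_ * _).
have [/addIn p1 /addIn p2] := monomial_displaces xp.
suff -> : ptgt p = psrc p by [].
rewrite [LHS]surjective_pairing [RHS]surjective_pairing.
by congr pair; apply: val_inj.
Qed.

Lemma jmonM al be ga al' be' ga' :
  jmon al be ga * jmon al' be' ga' = jmon (al + al') (be + be') (ga + ga').
Proof.
rewrite /jmon !exprD.
have ab m m' : ja ^+ m * jb ^+ m' = jb ^+ m' * ja ^+ m.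
  exact/commrX/commr_sym/commrX/commr_sym/jab_comm.
have ac m m' : ja ^+ m * jc ^+ m' = jc ^+ m' * ja ^+ m.
  exact/commrX/commr_sym/commrX/commr_sym/jac_comm.
have bc m m' : jb ^+ m * jc ^+ m' = jc ^+ m' * jb ^+ m.
  exact/commrX/commr_sym/commrX/commr_sym/jbc_comm.
rewrite !mulrA; congr (_ * _).
rewrite -!mulrA; congr (_ * _).
rewrite !mulrA -[_ * ja ^+ al']mulrA -ac mulrA -ab -!mulrA; congr (_ * (_ * _)).
by rewrite -bc.
Qed.

Lemma jcycleX m : jcycle ^+ m = jmon m m m.
Proof.
by elim: m => [|m IHm]; rewrite ?exprS ?IHm ?jmonM // /jmon !mulr1.
Qed.

Lemma jmonMA al be ga al' be' ga' x :
  jmon al be ga * (jmon al' be' ga' * x) =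
  jmon (al + al') (be + be') (ga + ga') * x.
Proof. by rewrite -jmonM mulrA. Qed.

Lemma jmon_a : jmon 1 0 0 = ja. Proof. by rewrite /jmon !mulr1. Qed.
Lemma jmon_b : jmon 0 1 0 = jb. Proof. by rewrite /jmon mulr1 mul1r. Qed.
Lemma jmon_c : jmon 0 0 1 = jc. Proof. by rewrite /jmon !mul1r. Qed.

Lemma rel_deterministic (r : rel (vertex Q)) :
  (forall u v w, r u v -> r u w -> v = w) ->
  @deterministic Q (fun z => r (src z) (tgt z)).
Proof.
move=> rdet y z ry rz yz; apply: val_inj.
rewrite [LHS]surjective_pairing [RHS]surjective_pairing; congr pair => //.
by apply: (rdet (src y)); [exact: ry|rewrite yz; exact: rz].
Qed.

(** A path is trivial or ends with an arrow of a well-defined type. *)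
Lemma jidem_expand (i : vertex Q) (x : J) :
  exists c xa xb xc, x * jidem W i =
    c *: jidem W i + ja * (xa * jidem W i) + jb * (xb * jidem W i) +
    jc * (xc * jidem W i).
Proof.
rewrite -[x]jpiK; set y := repr x.
pose ya := left_quotient Pa y.
pose yb := left_quotient Pb y.
pose yc := left_quotient Pc y.
exists (cpa_coef y i [::]), (jpi W ya), (jpi W yb), (jpi W yc).
pose e := cpa_idem F i.
transitivity (jpi W (cpa_coef y i [::] *: e + sa * (ya * e) + sb * (yb * e) +
    sc * (yc * e))); last first.
  by rewrite !jpiD jpiZ !jpiM.
rewrite -[LHS](rmorphM (jpi W)) !mulrA; congr (jpi W _).
have vtx (u v : vertex Q) : u.1 = v.1 :> nat -> u.2 = v.2 :> nat -> u = v.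
  case: u v => [u1 u2] [v1 v2] /= uv1 uv2; congr pair; exact: val_inj.
have deta : deterministic Pa.
  apply: (@rel_deterministic (@is_a n k)) => u v w; rewrite /is_a => uv uw.
  by apply: vtx; lia.
have detb : deterministic Pb.
  apply: (@rel_deterministic (@is_b n k)) => u v w; rewrite /is_b => uv uw.
  by apply: vtx; lia.
have detc : deterministic Pc.
  apply: (@rel_deterministic (@is_c n k)) => u v w; rewrite /is_c => uv uw.
  by apply: vtx; lia.
apply/funext => p; rewrite cpaM_idem.
have addE (s t : cpalg F Q) : (s + t) p = (s p : F) + (t p : F) by [].
rewrite !addE !cpaM_idem.
case pE: (parr p) => [|z s].
  rewrite !arrow_sumM pE !mul0r !addr0 cpa_scale_idemE pE andbT.
  case: eqP => [pi|_]; last by rewrite !mulr0.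
  rewrite !mulr1 /cpa_coef insubT //=.
  by congr y; apply: qpath_eq; rewrite ?pE.
rewrite !(@left_quotientK _ _ _ _ _ z) ?pE //.
rewrite cpa_scale_idemE pE andbF mulr0.
by have [[-> /negPf-> /negPf->]|[/negPf-> -> /negPf->]|[/negPf-> /negPf-> ->]]
  := arrow_typeP z; rewrite !mul0r mul1r ?addr0 ?add0r.
Qed.

Hypothesis k_lt_n : (k < n)%N.

Lemma ja_nilpotent : ja ^+ n = 0.
Proof.
rewrite -rmorphXn -[RHS](rmorph0 (jpi W)); congr (jpi W _); apply/funext => p.
apply/eqP; apply/negPn/negP => /(displacesX sa_displaces) [].
have := ltn_ord (ptgt p).1; have := ltn_ord (psrc p).1; lia.
Qed.

Lemma jb_nilpotent : jb ^+ n = 0.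
Proof.
rewrite -rmorphXn -[RHS](rmorph0 (jpi W)); congr (jpi W _); apply/funext => p.
apply/eqP; apply/negPn/negP => /(displacesX sb_displaces) [].
have := ltn_ord (ptgt p).2; have := ltn_ord (psrc p).2; lia.
Qed.

Lemma jc_nilpotent : jc ^+ n = 0.
Proof.
rewrite -rmorphXn -[RHS](rmorph0 (jpi W)); congr (jpi W _); apply/funext => p.
apply/eqP; apply/negPn/negP => /(displacesX sc_displaces) [].
have := ltn_ord (ptgt p).2; have := ltn_ord (psrc p).2; lia.
Qed.

Lemma jmon_big al be ga : (3 * n <= al + be + ga)%N -> jmon al be ga = 0.
Proof.
move=> big; rewrite /jmon.
have nil (x : J) m : x ^+ n = 0 -> (n <= m)%N -> x ^+ m = 0.
  by move=> xn nm; rewrite -(subnK nm) exprD xn mulr0.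
have [al_n|al_n] := leqP n al.
  by rewrite (nil _ _ ja_nilpotent) // !mul0r.
have [be_n|be_n] := leqP n be.
  by rewrite (nil _ _ jb_nilpotent) // mulr0 mul0r.
by rewrite (nil _ _ jc_nilpotent) ?mulr0 //; lia.
Qed.

(** The monomials [jmon al be ga * jidem W i] span [J e_i]: expanding [x e_i]
    again and again with [jidem_expand] leaves a remainder divisible by
    monomials of growing degree, which vanish from degree [3 n] on.  Linear
    forms spare the enumeration of the terms. *)
Lemma jmon_generate (i : vertex Q) (phi : J -> F) :
  {morph phi : x y / x + y} -> scalable_for *%R phi ->
  (forall al be ga, phi (jmon al be ga * jidem W i) = 0) ->
  forall x, phi (x * jidem W i) = 0.
Proof.
move=> phiD phiZ phi0 x.
suff phiL L : forall al be ga x, (3 * n <= al + be + ga + L)%N ->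
    phi (jmon al be ga * (x * jidem W i)) = 0.
  by have := phiL (3 * n) 0 0 0 x (leqnn _); rewrite /jmon !mul1r.
elim: L => {x} [|L IHL] al be ga x bound.
  rewrite jmon_big ?mul0r; last by rewrite addn0 in bound.
  by have := phiZ 0 0; rewrite scale0r mul0r.
have [c [xa [xb [xc ->]]]] := jidem_expand i x.
rewrite !mulrDr !phiD -jmon_a -jmon_b -jmon_c !jmonMA.
rewrite !IHL ?addr0; try lia.
by rewrite jscaleAr phiZ phi0 mulr0.
Qed.

End RectangleAlgebra.

(** * Subspaces stable under a nilpotent map *)

Section LinearAlgebra.
Variables (F : fieldType) (d : nat).

(** Each application of the nilpotent map [N] drops the dimension of a nonzero
    stable subspace. *)
Lemma nilpotent_stable_rank m (V : 'M[F]_(m, d)) (N : 'M[F]_d) s :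
  (V *m N <= V)%MS -> N ^+ s = 0 -> V *m N ^+ \rank V = 0.
Proof.
move=> VN Ns.
have stab t : (V *m N ^+ t.+1 <= V *m N ^+ t)%MS.
  by rewrite exprS -mulmxE mulmxA submxMr.
have drop t : V *m N ^+ t != 0 ->
    (\rank (V *m N ^+ t.+1) < \rank (V *m N ^+ t))%N.
  move=> Vt; rewrite ltnNge; apply: contra Vt => rk.
  have back : (V *m N ^+ t <= V *m N ^+ t.+1)%MS.
    by have [_ <-] := mxrank_leqif_sup (stab t); rewrite eqn_leq rk mxrankS.
  have back_iter u : (V *m N ^+ t <= V *m N ^+ (t + u))%MS.
    elim: u => [|u IHu]; first by rewrite addn0.
    apply: submx_trans back _; rewrite addnS !exprSr -!mulmxE !mulmxA.
    exact: submxMr.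
  have := back_iter s; rewrite exprD Ns mulr0 mulmx0.
  by move/submx0null->.
have bound t : (\rank (V *m N ^+ t) <= \rank V - t)%N.
  elim: t => [|t IHt]; first by rewrite expr0 mulmx1 subn0.
  have [Vt|/drop lt] := eqVneq (V *m N ^+ t) 0; last by lia.
  by rewrite exprSr -mulmxE mulmxA Vt mul0mx mxrank0.
apply/eqP; rewrite -mxrank_eq0 -leqn0.
by have := bound (\rank V); rewrite subnn.
Qed.

(** [N] maps the kernel of [N^(t+1)] in [E] to that of [N^t], and the fibres
    have dimension at most 1. *)
Lemma uniserial_ker_rank (E N : 'M[F]_d) t : (E *m N <= E)%MS ->
  (\rank (E :&: kermx N) <= 1)%N -> (\rank (E :&: kermx (N ^+ t)) <= t)%N.
Proof.
move=> EN K1; elim: t => [|t IHt].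
  rewrite leqn0 mxrank_eq0 -submx0; apply: submx_trans (capmxSr _ _) _.
  by rewrite expr0 submx0 kermx_eq0 row_free_unit unitmx1.
set A := (E :&: _)%MS; rewrite -(mxrank_mul_ker A N) addnC -add1n leq_add //.
  apply: leq_trans K1; apply/mxrankS/capmxS => //; exact: capmxSl.
apply: leq_trans IHt; apply/mxrankS; rewrite sub_capmx; apply/andP; split.
  by apply: submx_trans EN; apply/submxMr/capmxSl.
apply/sub_kermxP; rewrite -mulmxA.
have /sub_kermxP := capmxSr E (kermx (N ^+ t.+1)).
by rewrite -/A exprS -mulmxE.
Qed.

End LinearAlgebra.

(** * Submodules of an essential extension of a simple module *)

Section EssentialExtension.
Variables (n k : nat) (F : fieldType).
Hypothesis k_lt_n : (k < n)%N.
Local Notation Q := (rect_quiver n k).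
Local Notation W := (rect_potential n k F).
Local Notation J := (jacobian_algebra W).
Local Notation mon := (@jmon n k F).

Lemma ractM (M : rmodule W) x y : ract M (x * y) = ract M x *m ract M y.
Proof. exact: rmorphM. Qed.

Lemma mul_ract_generate (M : rmodule W) (i : vertex Q) (l : 'cV[F]_(rdim M))
    m (v : 'M[F]_(m, rdim M)) :
  ract M (jidem W i) *m l = l ->
  (forall al be ga, v *m ract M (mon al be ga) *m l = 0) ->
  forall x, v *m ract M x *m l = 0.
Proof.
move=> il v0 x; apply/matrixP => r c; rewrite ord1 mxE [RHS]mxE {c}.
pose phi y := (v *m ract M y *m l) r 0.
have phiE y : phi (y * jidem W i) = phi y.
  by rewrite /phi ractM mulmxA -[_ *m _ *m l]mulmxA il.
suff : phi x = 0 by rewrite /phi mxE.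
rewrite -phiE; apply: (jmon_generate k_lt_n (phi := phi)) => [y z|a y|al be ga].
- by rewrite /phi raddfD /= mulmxDr mulmxDl mxE.
- by rewrite /phi ract_scalable -scalemxAr -scalemxAl mxE.
- by rewrite phiE /phi v0 mxE.
Qed.

(** The column [l] is a linear form on [M] which factors through [M e_i] and
    whose kernel contains no nonzero submodule (see [mul_ract_generate]). *)
Definition separated_by (M : rmodule W) (i : vertex Q) (l : 'cV[F]_(rdim M)) :=
  ract M (jidem W i) *m l = l /\
  forall m (v : 'M[F]_(m, rdim M)),
    (forall al be ga, v *m ract M (mon al be ga) *m l = 0) -> v = 0.

(** A linear form that does not vanish on the simple submodule, composed with
    the action of [e_i], will do.  The largest submodule [K] in its kernel meets
    [S] in a proper submodule of [S], that is in 0; so [K = 0], the extension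
    being essential. *)
Lemma essential_separated (S M : rmodule W) (i : vertex Q)
    (f : 'M[F]_(rdim S, rdim M)) :
  simple_module S -> concentrated_at i S -> essential_mono f ->
  exists l, @separated_by M i l.
Proof.
move=> [S0 S_simple] Si [f_hom f_free f_ess].
have f0 : f != 0.
  by rewrite -mxrank_eq0 (eqP f_free) -lt0n.
have [r [c frc]] : exists r c, f r c != 0.
  apply: contrapT => f_eq0; case/eqP: f0; apply/matrixP => r c; rewrite mxE.
  by apply/eqP/negPn/negP => frc; apply: f_eq0; exists r, c.
pose l := ract M (jidem W i) *m delta_mx c 0 : 'cV[F]_(rdim M).
have fl : f *m l != 0.
  apply: contra_neq frc; rewrite /l mulmxA -f_hom Si mul1mx => /matrixP/(_ r 0).
  by rewrite -colE !mxE.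
have il : ract M (jidem W i) *m l = l by rewrite /l mulmxA -ractM jidemK.
exists l; split=> // m v v0.
(* by mul_ract_generate, K is the largest submodule killed by l; monomials of
   degree at least 3 n vanish, so finitely many suffice *)
pose K : 'M_(rdim M) := (\bigcap_(t : 'I_(3 * n) * 'I_(3 * n) * 'I_(3 * n))
   kermx (ract M (mon t.1.1 t.1.2 t.2) *m l))%MS.
have KP m' (u : 'M_(m', rdim M)) :
    (u <= K)%MS <-> forall x, u *m ract M x *m l = 0.
  split=> [uK|u0]; last first.
    by apply/sub_bigcapmxP => t _; apply/sub_kermxP; rewrite mulmxA.
  apply: mul_ract_generate il _ => al be ga.
  have [big|small] := leqP (3 * n) (al + be + ga).
    by rewrite jmon_big // raddf0 mulmx0 mul0mx.
  have al_lt : (al < 3 * n)%N by lia.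
  have be_lt : (be < 3 * n)%N by lia.
  have ga_lt : (ga < 3 * n)%N by lia.
  move/sub_bigcapmxP/(_ (Ordinal al_lt, Ordinal be_lt, Ordinal ga_lt) isT): uK.
  by move/sub_kermxP; rewrite mulmxA.
have K_sub : submodule K.
  move=> x; apply/KP => y; rewrite -[K *m _ *m _]mulmxA -ractM.
  exact: (KP _ K).1.
have vK : (v <= K)%MS by apply/KP; exact: mul_ract_generate il v0.
suff K0 : K = 0 by apply/eqP; rewrite -submx0 -K0.
apply/eqP/negPn/negP => /(f_ess _ K_sub); set A := (K :&: f)%MS => A0.
(* T is the preimage of K in S *)
pose T := kermx (f *m cokermx K).
have TP m' (u : 'M_(m', rdim S)) : (u <= T)%MS = (u *m f <= K)%MS.
  by rewrite sub_kermx mulmxA -submxE.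
have T_sub : submodule T.
  move=> x; rewrite TP -mulmxA f_hom mulmxA.
  apply: submx_trans (K_sub x); by apply: submxMr; rewrite -TP submx_refl.
case: (S_simple T T_sub) => [T0|T_full].
  have /submxP[s As] : (A <= f)%MS by exact: capmxSr.
  have : (s <= T)%MS by rewrite TP -As capmxSl.
  by rewrite T0 submx0 => /eqP s0; rewrite As s0 mul0mx eqxx in A0.
have : (1%:M <= T)%MS by exact: submx_full.
rewrite TP mul1mx => /KP/(_ 1); rewrite rmorph1 mulmx1 => fl0.
by rewrite fl0 eqxx in fl.
Qed.

Variables (M : rmodule W) (i : vertex Q) (l : 'cV[F]_(rdim M)).
Hypothesis l_sep : @separated_by M i l.
Local Notation E j := (ract M (jidem W j)).
Local Notation N := (ract M (@jcycle n k F)).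

Lemma ract_cycle_idem j : E j *m N = N *m E j.
Proof. by rewrite -!ractM jcycle_idem. Qed.

Lemma ract_cycle_nilpotent : N ^+ n = 0.
Proof.
rewrite -rmorphXn /= jcycleX. rewrite (jmon_big F k_lt_n) ?raddf0 //; lia.
Qed.

Lemma ract_idemK j : E j *m E j = E j.
Proof. by rewrite -ractM jidemK. Qed.

(** On vectors of [M e_j] killed by [U], the form [l] only sees the monomials
    from [i] to [j] that are not divisible by [U], and there is at most one of
    them. *)
Lemma cycle_ker_rank j : (\rank (E j :&: kermx N) <= 1)%N.
Proof.
have [il v0] := l_sep; set A := (_ :&: _)%MS.
(* the exponents of the monomial from i to j with an exponent equal to 0 *)
pose ga0 := maxn (i.1 - j.1) (i.2 - j.2).
pose c := ract M (mon (j.1 + ga0 - i.1) (j.2 + ga0 - i.2) ga0) *m l.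
suff A0 : \rank (A :&: kermx c) = 0%N.
  by rewrite -(mxrank_mul_ker A c) A0 addn0 rank_leq_col.
apply/eqP; rewrite mxrank_eq0; apply/eqP/v0 => al be ga; set v := (A :&: _)%MS.
have vE : v *m E j = v.
  have /submxP[w ->] : (v <= E j)%MS.
    by apply: submx_trans (capmxSl _ _) (capmxSl _ _).
  by rewrite -mulmxA ract_idemK.
have vN : v *m N = 0.
  by apply/sub_kermxP; apply: submx_trans (capmxSl _ _) (capmxSr _ _).
have vc : v *m c = 0 by apply/sub_kermxP; exact: capmxSr.
have [/and3P[al_gt0 be_gt0 ga_gt0]|pos] :=
    boolP [&& (0 < al)%N, (0 < be)%N & (0 < ga)%N].
  have -> : mon al be ga = @jcycle n k F * mon al.-1 be.-1 ga.-1.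
    by rewrite /jcycle jmonM !add1n !prednK.
  by rewrite ractM mulmxA vN !mul0mx.
have -> : v *m ract M (mon al be ga) *m l =
    v *m ract M (jidem W j * mon al be ga * jidem W i) *m l.
  by rewrite !ractM !mulmxA vE -[in RHS]mulmxA il.
have [[ij1 ij2]|->] := jmon_displacement F i j al be ga; last first.
  by rewrite raddf0 mulmx0 mul0mx.
have [-> [-> ->]] : al = (j.1 + ga0 - i.1)%N /\
    be = (j.2 + ga0 - i.2)%N /\ ga = ga0.
  by rewrite /ga0; lia.
by rewrite 2!ractM !mulmxA vE -[_ *m _ *m l]mulmxA il -mulmxA.
Qed.

Lemma submodule_component m (V : 'M[F]_(m, rdim M)) j : submodule V ->
  (V *m E j :=: E j :&: kermx (N ^+ \rank (V *m E j)))%MS.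
Proof.
move=> V_sub; set V1 := V *m E j.
have V1N : (V1 *m N <= V1)%MS.
  by rewrite -mulmxA ract_cycle_idem mulmxA submxMr.
have V1K : (V1 <= E j :&: kermx (N ^+ \rank V1))%MS.
  rewrite sub_capmx submxMl; apply/sub_kermxP.
  exact: nilpotent_stable_rank V1N ract_cycle_nilpotent.
apply/eqmxP; rewrite V1K /=.
have [_ <-] := mxrank_leqif_sup V1K; rewrite eqn_leq mxrankS //.
apply: uniserial_ker_rank (cycle_ker_rank j).
by rewrite ract_cycle_idem submxMl.
Qed.

Lemma submodule_dim_vector m m'
    (V : 'M[F]_(m, rdim M)) (V' : 'M[F]_(m', rdim M)) :
  submodule V -> submodule V' ->
  (forall j, \rank (V *m E j) = \rank (V' *m E j)) -> (V <= V')%MS.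
Proof.
move=> V_sub V'_sub rk.
have -> : V = \sum_j V *m E j.
  transitivity (V *m ract M (\sum_j jidem W j)).
    by rewrite jidem_sum (rmorph1 (ract M)) mulmx1.
  by rewrite raddf_sum mulmx_sumr.
apply: summx_sub => j _.
rewrite (submodule_component j V_sub) rk -(submodule_component j V'_sub).
exact: V'_sub.
Qed.

End EssentialExtension.

(** * Coefficients of the F-polynomial *)

Section EulerCharacteristics.
Variable R : realType.
Local Notation C := (complexes R).

Lemma quiver_grassmannian_euler_char (Q : quiver) (W : cpalg C Q)
    (M : rmodule W) (e : vertex Q -> nat) :
  (forall V V' : grassmannian C (\sum_j e j)%N (rdim M),
    quiver_grassmannian (M := M) (e := e) V ->
    quiver_grassmannian (M := M) (e := e) V' ->
    (frame_of V <= frame_of V')%MS) ->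
  euler_char R (set_type (@quiver_grassmannian R Q W M e)) = 0 \/
  euler_char R (set_type (@quiver_grassmannian R Q W M e)) = 1.
Proof.
move=> VV'.
have [pt|empty] :=
  pselect (inhabited (set_type (@quiver_grassmannian R Q W M e))).
  right; case: pt => pt; apply: (@euler_char_point _ _ pt) => x.
  apply: val_inj; rewrite -[val x]reprK -[val pt]reprK; apply/eqquotP.
  rewrite /= /frame_equiv; apply/andP.
  by split; apply: VV'; exact: set_mem (valP _).
left; apply: euler_char_empty => x; exact: empty (inhabits x).
Qed.

End EulerCharacteristics.

Section Coefficients.
Variable Q : quiver.

Lemma yvar_monomial (e : vertex Q -> nat) :
  exists2 mu : cmonom (vertex Q), forall j, mu j = e j &
    \prod_j yvar j ^+ e j = mkmalgU mu 1.
Proof.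
have mkM (mu nu : cmonom (vertex Q)) :
    mkmalgU mu 1 * mkmalgU nu 1 = mkmalgU (mmul mu nu) 1 :> ypoly Q.
  by rewrite malgM_def fgmulUU mulr1.
have yX j a : exists2 mu : cmonom (vertex Q),
      forall h, mu h = ((j == h) * a)%N &
    yvar j ^+ a = mkmalgU mu 1.
  elim: a => [|a [mu muE yE]].
    by exists mone => [h|//]; rewrite cm1 muln0.
  exists (mmul (ucm j) mu) => [h|]; last first.
    by rewrite exprS yE; exact: mkM.
  by rewrite cmM muE ucmE mulnS.
have [mu muE ->] : exists2 mu : cmonom (vertex Q),
    forall h, mu h = (\sum_(j <- index_enum (vertex Q)) (j == h) * e j)%N &
    \prod_(j <- index_enum (vertex Q)) yvar j ^+ e j = mkmalgU mu 1.
  elim: (index_enum _) => [|j s [mu muE yE]].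
    by exists mone => [h|]; rewrite big_nil // cm1.
  have [nu nuE zE] := yX j (e j).
  exists (mmul nu mu) => [h|]; first by rewrite cmM nuE muE big_cons.
  by rewrite big_cons yE zE; exact: mkM.
exists mu => // h; rewrite muE (bigD1 h) //= eqxx mul1n big1 ?addn0 // => j.
by move/negPf->.
Qed.

Lemma mcoeff_yvar_prod (e : vertex Q -> nat) (m : cmonom (vertex Q)) :
  mcoeff m (\prod_j yvar j ^+ e j) = [forall j, e j == m j]%:R.
Proof.
have [mu muE ->] := yvar_monomial e; rewrite mcoeffU1; congr (nat_of_bool _)%:R.
apply/eqP/forallP => [<- j|em]; first by rewrite muE.
by apply/eqP/cmP => j; rewrite muE (eqP (em j)).
Qed.

End Coefficients.
Theorem proposition6p6 (R : realType) (n k : nat)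
  (k_gt0 : (0 < k)%N) (k_lt_n : (k < n)%N)
  (i : vertex (rect_quiver n k))
  (Si Ii : rmodule (rect_potential n k (complexes R)))
  (Si_simple : simple_module Si) (Si_at_i : concentrated_at i Si)
  (Ii_hull : injective_hull Si Ii) (m : cmonom (vertex (rect_quiver n k))) :
  mcoeff m (F_polynomial Ii) != 0 -> mcoeff m (F_polynomial Ii) = 1.
Proof.
have [_ [f f_ess]] := Ii_hull.
have [l l_sep] := essential_separated k_lt_n Si_simple Si_at_i f_ess.
pose chi (e : {ffun vertex (rect_quiver n k) -> 'I_(rdim Ii).+1}) :=
  euler_char R (set_type (quiver_grassmannian (M := Ii) (e := fun j => e j))).
have chi01 e : chi e = 0 \/ chi e = 1.
  apply: quiver_grassmannian_euler_char.
  move=> V V' [V_sub /forallP Ve] [V'_sub /forallP V'e].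
  apply: (submodule_dim_vector k_lt_n l_sep) => // j.
  by rewrite (eqP (Ve j)) (eqP (V'e j)).
have -> : mcoeff m (F_polynomial Ii) =
    \sum_e chi e * [forall j, e j == m j :> nat]%:R.
  rewrite /F_polynomial raddf_sum; apply: eq_bigr => e _ /=.
  rewrite mcoeffZ; congr (_ * _).
  exact: (mcoeff_yvar_prod (fun j => e j)).
have [[e em]|no] := pselect (exists
    e : {ffun vertex (rect_quiver n k) -> 'I_(rdim Ii).+1},
    [forall j, e j == m j :> nat]); last first.
  by rewrite big1 ?eqxx // => e _; case: forallP => [em|]; rewrite ?mulr0 //;
    case: no; exists e; apply/forallP.
rewrite (bigD1 e) //= big1 ?addr0 => [|e' /eqP e'e]; last first.
  case: forallP => [e'm|]; rewrite ?mulr0 //; case: e'e; apply/ffunP => j.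
  by apply: val_inj; rewrite /= (eqP (e'm j)) (eqP (forallP em j)).
by rewrite em mulr1; case: (chi01 e) => ->; rewrite ?eqxx.
Qed.
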